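(* Let $\alpha:\mathbb{N}\to\mathbb{N}$, and assume that there are $\alpha_0,\alpha_1\in(0,1)$ with $$\liminf_{n\to\infty}n^{-\alpha_0}\alpha(n)=\infty\qquad\text{and}\qquad\limsup_{n\to\infty}n^{-\alpha_1}\alpha(n)=0.$$ Then, as $n\to\infty$, the quantities $m_{n,\alpha}$ and $v_{n,\alpha}$ have the asymptotic expansions $$m_{n,\alpha}\sim\frac{n}{\alpha(n)}\sum_{k=0}^{\infty}\frac{k!}{\bigl(\xi\bigl(\tfrac{n}{\alpha(n)}\bigr)\bigr)^{k}}$$ and $$v_{n,\alpha}\sim\frac{n}{\alpha(n)}\sum_{k=2}^{\infty}\frac{k!-1}{\bigl(\xi\bigl(\tfrac{n}{\alpha(n)}\bigr)\bigr)^{k}}.$$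
   Context: $\mathbb{N}$ denotes the positive integers. For $w$ in a neighbourhood $(1-\delta,1+\delta)$ of $1$ with $0<\delta<1$, $x_{n,\alpha}(w)$ denotes the unique positive solution $x$ of $\sum_{j=1}^{\alpha(n)}x^j=\frac{n}{w}$. It is a smooth function of $w$, and $x_{n,\alpha}'$ denotes its derivative with respect to $w$. Define $$m_{n,\alpha}:=\sum_{j=1}^{\alpha(n)}\frac{x_{n,\alpha}(1)^j}{j},\qquad v_{n,\alpha}:=m_{n,\alpha}+n\,\frac{x_{n,\alpha}'(1)}{x_{n,\alpha}(1)}.$$ For $u>1$, $\xi=\xi(u)$ denotes the non-zero solution of $\exp(\xi)=1+u\xi$, with $\xi(1)=0$ (so $\log u<\xi(u)\le 2\log u$ for $u>1$). Asymptotic expansion: if $(\phi_k)$ is a sequence of functions with $\phi_{k+1}(n)=o(\phi_k(n))$ as $n\to\infty$ for every $k$, then $f(n)\sim\sum_{k=k_0}^\infty a_k\phi_k(n)$ means that for every $N\ge k_0$, $f(n)=\sum_{k=k_0}^N a_k\phi_k(n)+o(\phi_N(n))$ as $n\to\infty$; the series need not converge. Here $\phi_k(n)=\frac{n}{\alpha(n)}\,\xi\bigl(\tfrac{n}{\alpha(n)}\bigr)^{-k}$. *)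

(* Defs.v *)
From mathcomp Require Import all_boot all_order all_algebra.
From mathcomp Require Import all_classical all_reals all_analysis.
Set Implicit Arguments.
Unset Strict Implicit.
Unset Printing Implicit Defensive.
Import Order.TTheory GRing.Theory Num.Theory.
Import numFieldNormedType.Exports.
Local Open Scope classical_set_scope.
Local Open Scope ring_scope.

(* The positive integers are represented by [nat]; index 0 is irrelevant to
   every notion below, all of them being used only as [n] tends to infinity. *)

Section Saddle.
Context {R : realType}.
Implicit Types (alpha : nat -> nat) (n k : nat) (w u : R).

(* For n, alpha n, w > 0 the left-hand side is a strictly increasing bijection
   of the positive reals, so this set is a singleton. *)
Definition x_sol alpha n w : R :=
  xget 0 [set x : R | 0 < x /\
                      \sum_(1 <= j < (alpha n).+1) x ^+ j = n%:R / w].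

Definition m_ alpha n : R :=
  \sum_(1 <= j < (alpha n).+1) x_sol alpha n 1 ^+ j / j%:R.

Definition v_ alpha n : R :=
  m_ alpha n + n%:R * (derive1 (x_sol alpha n) 1 / x_sol alpha n 1).

(* For u > 1 the set is a singleton, by strict convexity of the exponential;
   for u = 1 it is empty, and the default value gives xi 1 = 0. *)
Definition xi u : R := xget 0 [set z : R | z != 0 /\ expR z = 1 + u * z].

Definition scale alpha k n : R :=
  n%:R / (alpha n)%:R * xi (n%:R / (alpha n)%:R) ^- k.

(* f ~ \sum_(k >= k0) a k * phi k; this includes the requirement that (phi k)
   be an asymptotic scale. *)
Definition asymptotic_expansion (f : nat -> R) (k0 : nat) (a : nat -> R)
    (phi : nat -> nat -> R) : Prop :=
  (forall k, phi k.+1 =o_\oo phi k) /\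
  (forall N, (k0 <= N)%N ->
     (fun n => f n - \sum_(k0 <= k < N.+1) a k * phi k n) =o_\oo phi N).

End Saddle.

(* Main.v *)
Require Import Defs.
From mathcomp Require Import all_boot all_order all_algebra.
From mathcomp Require Import all_classical all_reals all_analysis.
From mathcomp Require Import ring lra.
Set Implicit Arguments.
Unset Strict Implicit.
Unset Printing Implicit Defensive.
Import Order.TTheory GRing.Theory Num.Theory.
Import numFieldNormedType.Exports.
Local Open Scope classical_set_scope.
Local Open Scope ring_scope.

(** Write [a] for [alpha n], [u] for [n / a], [x] for the saddle point at
    [w = 1], and put [s = a * (1 - x^-1)].  Summing the geometric series turns
    the saddle point equation into [x ^+ a = 1 + u * s], that is
    [(1 - s / a) ^- a = 1 + u * s], a perturbation of the equation
    [expR xi = 1 + u * xi] which defines [xi u]; comparing the two gives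
    [0 <= xi u - s <= 4 * s ^+ 2 / a] ([le_xi], [xi_sub_saddle]).

    The growth hypotheses make [1 / a] and [1 / u] smaller than a fixed negative
    power of [n], whereas [xi u] is at most logarithmic in [n].  An error term
    with a factor [1 / a] or [1 / sqrt u] is therefore smaller than every power
    of [1 / xi u], and the proof computes modulo such negligible sequences
    ([eqneg]); in particular [1 / s] and [1 / xi u] are interchangeable.

    For [m_], the indices [j <= a / 2] contribute at most
    [x ^+ (a / 2) * (1 + ln n)], of order [sqrt (u * s) * ln n], which is
    negligible against [u].  On the remaining indices, repeated summation by
    parts against [1 / (j * (j + 1) * ... * (j + k))] shows that suitably
    normalised sums [p k] are bounded and satisfy
    [p k = 1 + (k + 1) / xi u * p k.+1] modulo negligible sequences
    ([half_block_recursion]).  Iterating from [p 0], which is congruent to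
    [m_ / u], produces the coefficients [k!] ([recursion_expansion]).

    For [v_], implicit differentiation gives [n * x' / x = - u / (1 - z)] with
    [z] congruent to [1 / xi u] ([v_gap]).  The sequence [t = 1 / (1 - z)] obeys
    [t = 1 + z * t], which is the same kind of recursion with all coefficients
    equal to [1]; subtracting the two expansions leaves [k! - 1], which vanishes
    for [k < 2]. *)

(** * Sequences of moderate and of negligible growth *)

Section GrowthClasses.
Context {R : realType}.
Implicit Types (f g h : nat -> R) (e C : R).

(** Moderate sequences form a ring containing the powers of [ln n], and
    negligible sequences form an ideal of it.  Quantifying over the exponents
    keeps constants and logarithms out of all later estimates. *)
Definition moderate f :=
  forall e, 0 < e -> \forall n \near \oo, `|f n| <= n%:R `^ e.

Definition negligible f :=
  exists2 e, 0 < e & \forall n \near \oo, `|f n| <= n%:R `^ (- e).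

Definition eqneg f g := negligible (fun n => f n - g n).

Lemma near_ge_powR C e : 0 < e -> \forall n \near \oo, C <= n%:R `^ e.
Proof.
move=> e0; near=> n; apply: (le_trans (ler_norm C)).
have -> : `|C| = (`|C| `^ e^-1) `^ e.
  by rewrite -powRrM mulVf ?gt_eqF// powRr1.
apply: ge0_ler_powR; rewrite ?nnegrE ?powR_ge0 ?ler0n//; first exact: ltW.
by near: n; exact: nbhs_infty_ger.
Unshelve. all: by end_near. Qed.

Lemma near_pos : \forall n \near \oo, 0 < n%:R :> R.
Proof. by exists 1%N => // n /= n1; rewrite ltr0n. Qed.

Lemma moderate_of_le f :
  (forall e, 0 < e ->
     exists C, \forall n \near \oo, `|f n| <= C * n%:R `^ e) -> moderate f.
Proof.
move=> H e e0; have e20 : 0 < e / 2 by lra.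
have [C HC] := H _ e20.
have n0 := near_pos.
near=> n.
have -> : e = e / 2 + e / 2 by lra.
rewrite powRD; last by apply/implyP => _; rewrite gt_eqF//; near: n.
apply: (le_trans (y := C * n%:R `^ (e / 2))); first by near: n.
apply: ler_wpM2r; first exact: powR_ge0.
by near: n; exact: near_ge_powR.
Unshelve. all: by end_near. Qed.

Lemma le_moderate f g :
  (\forall n \near \oo, `|f n| <= g n) -> moderate g -> moderate f.
Proof.
move=> fg mg e e0; apply: filterS2 fg (mg e e0) => n fn gn.
exact: le_trans fn (le_trans (ler_norm _) gn).
Qed.


Lemma moderate_cst C : moderate (fun=> C).
Proof. by move=> e e0; exact: near_ge_powR. Qed.

Lemma moderateM f g : moderate f -> moderate g -> moderate (fun n => f n * g n).
Proof.
move=> mf mg e e0; have e20 : 0 < e / 2 by lra.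
apply: filterS3 near_pos (mf _ e20) (mg _ e20) => n n0 fn gn.
rewrite normrM; have -> : e = e / 2 + e / 2 by lra.
rewrite powRD; last by apply/implyP => _; rewrite gt_eqF.
exact: ler_pM.
Qed.

Lemma moderateX f k : moderate f -> moderate (fun n => f n ^+ k).
Proof.
move=> mf; elim: k => [|k IH]; first exact: moderate_cst.
rewrite (_ : (fun n => _) = (fun n => f n * f n ^+ k)); first exact: moderateM.
by apply/funext => n; rewrite exprS.
Qed.

Lemma moderateD f g : moderate f -> moderate g -> moderate (fun n => f n + g n).
Proof.
move=> mf mg; apply: moderate_of_le => e e0; exists 2.
apply: filterS2 (mf _ e0) (mg _ e0) => n fn gn.
by apply: le_trans (ler_normD _ _) _; lra.
Qed.

(** This is [e * ln n = ln (n `^ e) < n `^ e]. *)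
Lemma moderate_ln : moderate (fun n => ln (n%:R : R)).
Proof.
apply: moderate_of_le => e e0; exists e^-1.
near=> n; have n1 : 1 <= n%:R :> R by near: n; exact: nbhs_infty_ger.
rewrite ger0_norm ?ln_ge0// -(ler_pM2l e0) mulrA divff ?gt_eqF// mul1r.
rewrite -ln_powR; apply/ltW/ln_sublinear/powR_gt0.
by rewrite (lt_le_trans ltr01).
Unshelve. all: by end_near. Qed.

Lemma negligible_moderate f : negligible f -> moderate f.
Proof.
move=> [e e0 fe] e' e'0.
near=> n; have n1 : 1 <= n%:R :> R by near: n; exact: nbhs_infty_ger.
apply: (le_trans (y := n%:R `^ (- e))); first by near: n.
by apply: ler_powR => //; lra.
Unshelve. all: by end_near. Qed.

Lemma negligible0 : negligible (fun=> 0 : R).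
Proof. by exists 1 => //; near=> n; rewrite normr0 powR_ge0.
Unshelve. all: by end_near. Qed.

Lemma le_negligible f g :
  (\forall n \near \oo, `|f n| <= g n) -> negligible g -> negligible f.
Proof.
move=> fg [e e0 ge]; exists e => //; near=> n.
apply: (le_trans (y := g n)); first by near: n.
by apply: (le_trans (ler_norm _)); near: n.
Unshelve. all: by end_near. Qed.

Lemma negligible_near f g :
  (\forall n \near \oo, f n = g n) -> negligible g -> negligible f.
Proof.
move=> fg ng; apply: (@le_negligible _ (fun n => `|g n|)).
  by near=> n; rewrite [f n](_ : _ = g n)//; near: n.
by move: ng => [e e0 ge]; exists e => //; near=> n; rewrite normr_id; near: n.
Unshelve. all: by end_near. Qed.

Lemma negligibleMr f g :
  negligible f -> moderate g -> negligible (fun n => f n * g n).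
Proof.
move=> [e e0 fe] mg; exists (e / 2); first lra.
have e20 : 0 < e / 2 by lra.
apply: filterS3 near_pos fe (mg _ e20) => n n0 fn gn.
rewrite normrM; have -> : - (e / 2) = - e + e / 2 by lra.
rewrite powRD; last by apply/implyP => _; rewrite gt_eqF.
exact: ler_pM.
Qed.

Lemma negligibleMl f g :
  moderate f -> negligible g -> negligible (fun n => f n * g n).
Proof.
move=> mf ng; rewrite (_ : (fun n => _) = (fun n => g n * f n)).
  exact: negligibleMr.
by apply/funext => n; rewrite mulrC.
Qed.

Lemma negligible_le f C :
  negligible f -> 0 < C -> \forall n \near \oo, `|f n| <= C.
Proof.
move=> [e e0 fe] C0; near=> n.
have n0 : 0 < n%:R :> R by near: n; exact: near_pos.
apply: (le_trans (y := n%:R `^ (- e))); first by near: n.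
rewrite powRN invf_ple ?posrE ?powR_gt0//.
by near: n; exact: near_ge_powR.
Unshelve. all: by end_near. Qed.

Lemma negligibleD f g :
  negligible f -> negligible g -> negligible (fun n => f n + g n).
Proof.
move=> [e e0 fe] [e' e'0 ge']; pose d := Num.min e e' / 2.
have d0 : 0 < d by rewrite /d divr_gt0 ?lt_min ?e0.
exists d => //; near=> n.
have n1 : 1 <= n%:R :> R by near: n; exact: nbhs_infty_ger.
have n0 : n%:R != 0 :> R by rewrite gt_eqF// (lt_le_trans ltr01).
have nd : 2 <= n%:R `^ d :> R by near: n; exact: near_ge_powR.
have small c : Num.min e e' <= c -> n%:R `^ (- c) <= n%:R `^ (- d) * n%:R `^ (- d).
  move=> ce; rewrite -powRD; last by apply/implyP.
  by apply: ler_powR => //; rewrite /d; lra.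
have fn : `|f n| <= n%:R `^ (- d) * n%:R `^ (- d).
  by apply: le_trans (small e _); [near: n|rewrite ge_min lexx].
have gn : `|g n| <= n%:R `^ (- d) * n%:R `^ (- d).
  by apply: le_trans (small e' _); [near: n|rewrite ge_min lexx orbT].
apply: le_trans (ler_normD _ _) _; apply: le_trans (lerD fn gn) _.
rewrite -mulrDl -[leRHS]mul1r ler_wpM2r ?powR_ge0// powRN.
have nd0 : 0 < n%:R `^ d :> R by lra.
have := divff (lt0r_neq0 nd0).
have : 0 < (n%:R `^ d)^-1 :> R by rewrite invr_gt0.
by nra.
Unshelve. all: by end_near. Qed.

Lemma negligibleN f : negligible f -> negligible (fun n => - f n).
Proof. by move=> [e e0 fe]; exists e => //; near=> n; rewrite normrN; near: n.
Unshelve. all: by end_near. Qed.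

Lemma negligibleB f g :
  negligible f -> negligible g -> negligible (fun n => f n - g n).
Proof. by move=> nf /negligibleN; exact: negligibleD. Qed.

Lemma negligible_sqrt f : negligible f -> negligible (fun n => Num.sqrt (f n)).
Proof.
move=> [e e0 fe]; exists (e / 2); first lra.
near=> n; have fn : `|f n| <= n%:R `^ (- e) by near: n.
rewrite ger0_norm ?sqrtr_ge0//.
have -> : - (e / 2) = - e * 2^-1 by lra.
rewrite powRrM powR12_sqrt ?powR_ge0// ler_wsqrtr//.
exact: le_trans (ler_norm _) fn.
Unshelve. all: by end_near. Qed.

Lemma eqneg_refl f : eqneg f f.
Proof. by apply: (negligible_near _ negligible0); near=> n; rewrite subrr.
Unshelve. all: by end_near. Qed.

Lemma eqneg_near f g : (\forall n \near \oo, f n = g n) -> eqneg f g.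
Proof.
move=> fg; apply: (negligible_near _ negligible0); near=> n.
by apply/eqP; rewrite subr_eq0; apply/eqP; near: n.
Unshelve. all: by end_near. Qed.

Lemma eqneg_trans g f h : eqneg f g -> eqneg g h -> eqneg f h.
Proof.
move=> fg gh; apply: (negligible_near _ (negligibleD fg gh)).
by near=> n; rewrite addrA subrK.
Unshelve. all: by end_near. Qed.

Lemma eqnegD f f' g g' : eqneg f f' -> eqneg g g' ->
  eqneg (fun n => f n + g n) (fun n => f' n + g' n).
Proof.
move=> ff gg; apply: (negligible_near _ (negligibleD ff gg)).
by near=> n; ring.
Unshelve. all: by end_near. Qed.

Lemma moderate_eqneg f g : eqneg f g -> moderate g -> moderate f.
Proof.
move=> /negligible_moderate fg mg.
rewrite (_ : f = (fun n => f n - g n + g n)); first exact: moderateD.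
by apply/funext => n; rewrite subrK.
Qed.

Lemma eqnegM f f' g g' : moderate f' -> moderate g' ->
  eqneg f f' -> eqneg g g' ->
  eqneg (fun n => f n * g n) (fun n => f' n * g' n).
Proof.
move=> mf mg ff gg; have mg1 := moderate_eqneg gg mg.
apply: (negligible_near _ (negligibleD (negligibleMr ff mg1) (negligibleMl mf gg))).
by near=> n; ring.
Unshelve. all: by end_near. Qed.

End GrowthClasses.

(** * Expansions in inverse powers of a slowly growing sequence *)

Section Expansion.
Context {R : realType}.
Implicit Types (f g X : nat -> R) (a c : nat -> R) (q : nat -> nat -> R).

Definition diverges X := forall C, \forall n \near \oo, C <= X n.

Definition bounded_seq f := exists C, \forall n \near \oo, `|f n| <= C.

Lemma bounded_moderate f : bounded_seq f -> moderate f.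
Proof. by move=> [C fC]; exact: le_moderate fC (moderate_cst C). Qed.

Lemma inv_moderate X : diverges X -> moderate (fun n => (X n)^-1).
Proof.
move=> dX; apply: bounded_moderate; exists 1; apply: filterS (dX 1) => n X1.
have X0 : 0 < X n by lra.
by rewrite ger0_norm ?invr_ge0 ?invf_le1// ltW.
Qed.

(** Since [X^-1] and all [q k] are moderate, substituting the congruence for
    [q K] into a product by a fixed power of [X^-1] costs a negligible error. *)
Lemma iterated_recursion X c q : diverges X ->
  (forall k, bounded_seq (q k)) ->
  (forall k, eqneg (q k) (fun n => 1 + c k * (X n)^-1 * q k.+1 n)) ->
  forall K, eqneg (q 0) (fun n =>
    \sum_(k < K) (\prod_(i < k) c i) * X n ^- k +
    (\prod_(i < K) c i) * X n ^- K * q K n).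
Proof.
move=> dX bq rec; have mX := inv_moderate dX.
elim=> [|K IH].
  apply: eqneg_near; near=> n.
  by rewrite big_ord0 big_ord0 expr0 invr1 mulr1 mul1r add0r.
apply: eqneg_trans IH _.
pose s n := \sum_(k < K) (\prod_(i < k) c i) * X n ^- k.
pose p n := \prod_(i < K) c i * X n ^- K.
have mp : moderate p.
  apply: moderateM (moderate_cst _) _.
  rewrite (_ : (fun n => _) = (fun n => (X n)^-1 ^+ K)); first exact: moderateX.
  by apply/funext => n; rewrite exprVn.
have mr : moderate (fun n => 1 + c K * (X n)^-1 * q K.+1 n).
  apply: moderateD (moderate_cst 1) _; apply: moderateM.
    exact: moderateM (moderate_cst _) mX.
  exact: bounded_moderate.
apply: eqneg_trans (eqnegD (eqneg_refl s) (eqnegM mp mr (eqneg_refl p) (rec K))) _.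
apply: eqneg_near; near=> n.
by rewrite /s /p !big_ord_recr/= mulrDr mulr1 addrA exprSr invfM; ring.
Unshelve. all: by end_near. Qed.

(** The last term of [iterated_recursion] has the order [X ^- N.+1] because
    [q N.+1] is bounded; the negligible error is smaller still, as [X ^+ N.+1] is
    moderate. *)
Lemma recursion_expansion X c q : diverges X -> moderate X ->
  (forall k, bounded_seq (q k)) ->
  (forall k, eqneg (q k) (fun n => 1 + c k * (X n)^-1 * q k.+1 n)) ->
  forall N, exists C, \forall n \near \oo,
    `|q 0 n - \sum_(k < N.+1) (\prod_(i < k) c i) * X n ^- k|
      <= C * X n ^- N.+1.
Proof.
move=> dX mX bq rec N; have [B qB] := bq N.+1.
pose P : R := \prod_(i < N.+1) c i.
exists (1 + `|P| * B).
have := iterated_recursion dX bq rec N.+1.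
move=> /negligibleMr /(_ (moderateX N.+1 mX)) /negligible_le /(_ ltr01).
apply: filterS3 (dX 1) qB => n X1 qn; rewrite -/P.
set S := \sum_(k < _) _ => En.
have X0 : 0 < X n ^+ N.+1 by rewrite exprn_gt0//; lra.
rewrite ler_pdivlMr//.
have -> : (q 0 n - S) = (q 0 n - (S + P * X n ^- N.+1 * q N.+1 n))
                        + P * X n ^- N.+1 * q N.+1 n by ring.
rewrite -[X in _ * X](ger0_norm (ltW X0)) -normrM mulrDl.
apply: le_trans (ler_normD _ _) (lerD En _).
have -> : P * X n ^- N.+1 * q N.+1 n * X n ^+ N.+1 = P * q N.+1 n.
  by field; rewrite gt_eqF//; lra.
by rewrite normrM ler_wpM2l.
Unshelve. all: by end_near. Qed.

Lemma eqo_le (f g : nat -> R) :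
  (forall eps, 0 < eps -> \forall n \near \oo, `|f n| <= eps * `|g n|) ->
  f =o_\oo g.
Proof. by move=> H; apply/eqoP. Qed.

(** A remainder of the order of the next term of the scale is enough, as
    consecutive terms have the ratio [1 / xi], which tends to [0]. *)
Lemma expansion_of_dominated (alpha : nat -> nat) f (k0 : nat) a :
  diverges (fun n => xi (n%:R / (alpha n)%:R : R)) ->
  (forall N, (k0 <= N)%N -> exists C, \forall n \near \oo,
     `|f n - \sum_(k0 <= k < N.+1) a k * scale alpha k n|
       <= C * `|scale alpha N.+1 n|) ->
  asymptotic_expansion f k0 a (scale alpha).
Proof.
move=> dX H.
have step (k : nat) (C eps : R) : 0 < eps -> \forall n \near \oo,
    C * `|scale alpha k.+1 n| <= eps * `|scale alpha k n|.
  move=> e0; apply: filterS2 (dX 1) (dX (C / eps)) => n; rewrite /scale.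
  set X := xi _ => X1 XC; have X0 : 0 < X by lra.
  have -> : n%:R / (alpha n)%:R * X ^- k.+1 =
      n%:R / (alpha n)%:R * X ^- k * X^-1 by rewrite exprSr invfM; ring.
  rewrite [in leLHS]normrM mulrA mulrAC ler_wpM2r// normfV gtr0_norm//.
  by rewrite ler_pdivrMr// mulrC -ler_pdivrMr.
split=> [k|N kN]; apply: eqo_le => eps e0.
  by apply: filterS (step k 1 _ e0) => n; rewrite mul1r.
have [C HC] := H N kN.
by apply: filterS2 HC (step N C _ e0) => n; exact: le_trans.
Qed.

End Expansion.

(** * The comparison function [xi] and the rescaled saddle point *)

Section Xi.
Context {R : realType}.
Implicit Types (u s x : R).

(** Intermediate values of [expR z - u * z] at [z = ln u] and [z = 4 * u]; the
    left end point is positive and so excludes the trivial solution [z = 0]. *)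
Lemma xi_exists u : 1 < u -> exists z : R, z != 0 /\ expR z = 1 + u * z.
Proof.
move=> u1; have u0 : 0 < u by lra.
have l0 : 0 < ln u by exact: ln_gt0.
have lu : expR (ln u) = u by rewrite lnK.
have lb : u - u * ln u <= 1.
  have := expR_ge1Dx (- ln u); rewrite expRN lu => /(ler_wpM2r (ltW u0)).
  by rewrite mulVf ?gt_eqF//; lra.
have ub : 1 <= expR (4 * u) - u * (4 * u).
  have -> : 4 * u = 2 * u + 2 * u by ring.
  have := expR_ge1Dx (2 * u); rewrite expRD.
  by move: (expR _) => t; nra.
have luu : ln u <= 4 * u by have := ln_sublinear u0; lra.
have cf : {within `[ln u, 4 * u], continuous (fun z => expR z - u * z)}.
  apply: continuous_subspaceT => z.
  apply: cvgB; first exact: continuous_expR.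
  by apply: cvgM; [exact: cvg_cst|exact: cvg_id].
have [|z zin fz] := IVT luu cf (v := 1).
  by rewrite lu ge_min le_max lb ub orbT.
exists z; split; last by lra.
by move: zin; rewrite in_itv/= => /andP[zl _]; rewrite gt_eqF//; lra.
Qed.

Lemma xiP u : 1 < u -> 0 < xi u /\ expR (xi u) = 1 + u * xi u.
Proof.
move=> u1.
have [z0 E] : xi u != 0 /\ expR (xi u) = 1 + u * xi u.
  exact: xgetPex (xi_exists u1).
split=> //; rewrite lt_neqAle eq_sym z0/= leNgt; apply/negP => zn.
by have := expR_ge1Dx (xi u); rewrite E; nra.
Qed.

Lemma expR_le1DM (z : R) : expR z <= 1 + z * expR z.
Proof.
have := expR_ge1Dx (- z); rewrite expRN => /(ler_wpM2r (expR_ge0 z)).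
by rewrite mulVf ?gt_eqF ?expR_gt0//; lra.
Qed.

(** [u * xi u = expR (xi u) - 1 <= xi u * expR (xi u)]. *)
Lemma le_expR_xi u : 1 < u -> u <= expR (xi u).
Proof.
move=> u1; have [x0 E] := xiP u1; have := expR_le1DM (xi u).
rewrite [in leLHS]E lerD2l mulrC ler_pM2l//.
Qed.

(** One of the two factors [expR (xi u / 2)] of [expR (xi u)] absorbs the linear
    right-hand side [1 + u * xi u <= 2 * u * (1 + xi u / 2)]. *)
Lemma xi_le_ln u : 1 < u -> xi u <= 2 * ln (2 * u).
Proof.
move=> u1; have [x0 E] := xiP u1.
have : expR (xi u / 2) <= 2 * u.
  move: E; rewrite {1}[xi u](_ : _ = xi u / 2 + xi u / 2); last by lra.
  rewrite expRD; have := expR_ge1Dx (xi u / 2).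
  by move: (expR _) => t; nra.
have u20 : 0 < 2 * u by lra.
by rewrite -[X in _ <= X -> _](@lnK _ (2 * u)) ?posrE// ler_expR; lra.
Qed.

(** Convexity of the exponential: the chord from [0] to [s] has slope at most
    [u], whereas it has slope exactly [u] at [xi u]. *)
Lemma le_xi u s : 1 < u -> 0 < s -> expR s <= 1 + u * s -> s <= xi u.
Proof.
move=> u1 s0 Es; have [x0 E] := xiP u1; rewrite leNgt; apply/negP => xs.
have := expR_ge1Dx (s - xi u); move: Es.
have -> : expR s = expR (xi u) * expR (s - xi u) by rewrite -expRD addrC subrK.
have := expR_gt1Dx (lt0r_neq0 x0 : xi u != 0) => H1.
have Hs : u < expR (xi u).
  have xn0 : - xi u != 0 by rewrite oppr_eq0 gt_eqF.
  have := expR_gt1Dx xn0; rewrite expRN -(ltr_pM2r (expR_gt0 (xi u))).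
  by rewrite mulVf ?gt_eqF ?expR_gt0// {1}E; nra.
move: Hs; rewrite E; set d := s - xi u.
have -> : s = xi u + d by rewrite /d; lra.
have : 0 < d by rewrite /d; lra.
move: (expR d) => e; move: (xi u) x0 => z; nra.
Qed.

(** With [x = 1 / (1 - s / a)] the inequalities
    [1 - t <= expR (- t)] at [t = s / a] and [x <= expR (x - 1)] sandwich
    [x ^+ a]. *)
Lemma exp_sandwich (a : nat) x s : (0 < a)%N -> 1 < x ->
  s = a%:R * (1 - x^-1) -> expR s <= x ^+ a <= expR (s * x).
Proof.
move=> a0 x1 sE; have x0 : 0 < x by lra.
rewrite sE !(mulrC a%:R) -mulrA (mulrC a%:R) mulrA !expRM_natr.
apply/andP; split; rewrite ler_pXn2r ?nnegrE ?expR_ge0 ?(ltW x0)//.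
  rewrite -[leRHS]invrK -[leLHS]invrK lef_pV2 ?posrE ?invr_gt0 ?expR_gt0//.
  by rewrite -expRN; have := expR_ge1Dx (- (1 - x^-1)); lra.
have -> : (1 - x^-1) * x = x - 1 by field; lra.
by have := expR_ge1Dx (x - 1); lra.
Qed.

(** A saddle point that is not large forces [u] to be bounded; contraposed,
    [s] tends to infinity with [u]. *)
Lemma saddle_large (u s x : R) : 0 < s -> x <= 2 ->
  1 + u * s <= expR (s * x) -> u <= 2 * expR (2 * s).
Proof.
move=> s0 x2 us.
have h1 : expR (s * x) <= expR (2 * s) by rewrite ler_expR; nra.
have h2 := expR_le1DM (2 * s); rewrite -(ler_pM2r s0).
by move: (expR (2 * s)) h1 h2 => e; nra.
Qed.

(** Dividing the defining equations of [xi u] and of [s] gives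
    [expR (xi u - s * x) <= (1 + u * xi u) / (1 + u * s)
       <= expR ((xi u - s) / s)]. *)
Lemma xi_sub_saddle (a : nat) u s x : (0 < a)%N -> 1 < u -> 1 < x -> x <= 2 ->
  s = a%:R * (1 - x^-1) -> 2 <= s -> s <= xi u -> 1 + u * s <= expR (s * x) ->
  xi u - s <= 4 * s ^+ 2 / a%:R.
Proof.
move=> a0 u1 x1 x2 sE s2 sx us; have [z0 E] := xiP u1.
have a0' : 0 < a%:R :> R by rewrite ltr0n.
have : expR (xi u) <= expR (s * x + (xi u - s) / s).
  have := expR_ge1Dx ((xi u - s) / s); rewrite expRD E.
  move: us (expR_gt0 (s * x)); move: (expR _) (expR _) => A B us A0 HB.
  have s0 : s != 0 by rewrite gt_eqF//; lra.
  have -> : xi u = s + ((xi u - s) / s) * s by field.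
  have : 0 <= (xi u - s) / s by apply: divr_ge0; lra.
  move: ((xi u - s) / s) HB => r HB r0.
  have h : 1 + u * (s + r * s) <= (1 + u * s) * (1 + r) by nra.
  apply: le_trans h _; apply: ler_pM => //; nra.
rewrite ler_expR => H.
have sx1 : s * x - s = s ^+ 2 * x / a%:R.
  by rewrite sE; field; rewrite gt_eqF//; apply/andP; split => //; lra.
have d2 : (xi u - s) / s <= (xi u - s) / 2.
  apply: ler_wpM2l; first by lra.
  by rewrite lef_pV2 ?posrE//; lra.
have : s ^+ 2 * x / a%:R <= 2 * (s ^+ 2 / a%:R).
  by rewrite [leRHS]mulrA ler_pM2r ?invr_gt0//; nra.
by rewrite -mulrA; lra.
Qed.

End Xi.

(** * The saddle point of the geometric sum and its derivative *)

Section Saddle.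
Context {R : realType}.
Implicit Types (a n : nat) (x y : R) (alpha : nat -> nat).

Definition geomsum a x := \sum_(1 <= j < a.+1) x ^+ j.

Lemma geomsum_lt a x y : (0 < a)%N -> 0 < x -> x < y ->
  geomsum a x < geomsum a y.
Proof.
rewrite /geomsum; case: a => // a _ x0 xy.
rewrite big_nat_recl// [ltRHS]big_nat_recl// ltr_leD//.
by apply: ler_sum => j _; rewrite lerXn2r ?nnegrE// ltW// (lt_trans x0).
Qed.

Lemma geomsum_inj a x y : (0 < a)%N -> 0 < x -> 0 < y ->
  geomsum a x = geomsum a y -> x = y.
Proof.
move=> a0 x0 y0 xy; have [ltxy|ltyx|//] := ltgtP x y.
- by have := geomsum_lt a0 x0 ltxy; rewrite xy ltxx.
- by have := geomsum_lt a0 y0 ltyx; rewrite xy ltxx.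
Qed.

Lemma geomsumE a x : (x - 1) * geomsum a x = x * (x ^+ a - 1).
Proof.
rewrite /geomsum; elim: a => [|a IH].
  by rewrite big_geq// expr0 subrr !mulr0.
by rewrite big_nat_recr//= mulrDr IH !exprS; ring.
Qed.

Lemma geomsum_weighted a x :
  (x - 1) * (\sum_(1 <= j < a.+1) j%:R * x ^+ j) =
  a%:R * x ^+ a.+1 - geomsum a x.
Proof.
rewrite /geomsum; elim: a => [|a IH].
  by rewrite !big_geq// !mulr0 mul0r subrr.
by rewrite big_nat_recr//= [in RHS]big_nat_recr//= mulrDr IH -natr1 !exprS; ring.
Qed.

Lemma is_derive_geomsum a x :
  is_derive x 1 (geomsum a) (\sum_(1 <= j < a.+1) j%:R * x ^+ j.-1).
Proof.
elim: a => [|a IH].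
  rewrite big_geq// (_ : geomsum 0 = cst 0); first exact: is_derive_cst.
  by apply/funext => y; rewrite /geomsum big_geq.
rewrite big_nat_recr//= (_ : geomsum a.+1 = geomsum a + id ^+ a.+1).
  have := is_deriveD IH (is_deriveX a.+1 (is_derive_id x (1 : R))).
  by rewrite /GRing.scale/= mulr1.
by apply/funext => y; rewrite fctE exprfctE /geomsum big_nat_recr.
Qed.

Lemma continuous_geomsum a : continuous (geomsum a).
Proof.
move=> x; apply: differentiable_continuous; apply/derivable1_diffP.
by have [] := is_derive_geomsum a x.
Qed.

Lemma geomsum_gt0 a x : (0 < a)%N -> 0 < x -> 0 < geomsum a x.
Proof.
rewrite /geomsum; case: a => // a _ x0; rewrite big_nat_recl//.
apply: ltr_pwDl; first by rewrite expr1.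
by apply: sumr_ge0 => j _; rewrite exprn_ge0// ltW.
Qed.

Lemma x_sol_1P alpha n : (0 < alpha n)%N -> (0 < n)%N ->
  0 < (x_sol alpha n 1 : R) /\ geomsum (alpha n) (x_sol alpha n 1) = n%:R :> R.
Proof.
move=> a0 n0.
suff [x xP] : exists x : R, 0 < x /\ geomsum (alpha n) x = n%:R / 1.
  have /= [] := xgetPex 0 (ex_intro _ x xP : exists x, [set x : R | 0 < x /\
    \sum_(1 <= j < (alpha n).+1) x ^+ j = n%:R / 1] x).
  by rewrite -/(x_sol alpha n 1) divr1.
rewrite divr1; have n0' : (0 : R) < n%:R by rewrite ltr0n.
have s0 : geomsum (alpha n) 0 = 0 :> R.
  by rewrite /geomsum big_nat_cond big1// => -[|j]//; rewrite expr0n.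
have sn : n%:R <= geomsum (alpha n) (n%:R : R).
  rewrite /geomsum; case: (alpha n) a0 => // a _; rewrite big_nat_recl// expr1.
  by rewrite lerDl sumr_ge0// => j _; rewrite exprn_ge0// ltW.
have cS : {within `[0, n%:R], continuous (geomsum (alpha n) : R -> R)}.
  exact/continuous_subspaceT/continuous_geomsum.
have [|x] := IVT (ltW n0') cS (v := n%:R).
  by rewrite s0 ge_min le_max (ltW n0') sn orbT.
rewrite in_itv/= => /andP[x0 _] xE; exists x; split=> //.
rewrite lt_neqAle x0 andbT; apply/eqP => x00.
by move: xE n0'; rewrite -x00 s0 => <-; rewrite ltxx.
Qed.

Lemma x_sol_geomsum alpha n x : (0 < alpha n)%N -> (0 < n)%N -> 0 < x ->
  x_sol alpha n (n%:R / geomsum (alpha n) x) = x.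
Proof.
move=> a0 n0 x0; have S0 := geomsum_gt0 a0 x0.
have nn : n%:R != 0 :> R by rewrite pnatr_eq0 -lt0n.
have E : n%:R / (n%:R / geomsum (alpha n) x) = geomsum (alpha n) x.
  by field; rewrite nn gt_eqF.
rewrite /x_sol E.
have /= [] := xgetPex 0 (ex_intro _ x (conj x0 erefl) : exists z, [set z : R |
   0 < z /\ \sum_(1 <= j < (alpha n).+1) z ^+ j = geomsum (alpha n) x] z).
by move=> z0; exact: geomsum_inj.
Qed.

(** Near the saddle point [x_sol alpha n] is the inverse of
    [x |-> n / geomsum (alpha n) x], which gives its logarithmic derivative. *)
Lemma dlog_x_sol alpha n : (0 < alpha n)%N -> (0 < n)%N ->
  let x : R := x_sol alpha n 1 in
  derive1 (x_sol alpha n) 1 / x =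
  - (n%:R / \sum_(1 <= j < (alpha n).+1) j%:R * x ^+ j).
Proof.
move=> a0 n0 x; have [x0 Sx] := x_sol_1P a0 n0; rewrite -/x in x0 Sx.
have nn : n%:R != 0 :> R by rewrite pnatr_eq0 -lt0n.
set W := \sum_(1 <= j < _) _ * x ^+ j.
pose W' : R := \sum_(1 <= j < (alpha n).+1) j%:R * x ^+ j.-1.
have WE : W = x * W'.
  rewrite /W /W' mulr_sumr; apply: eq_big_nat => j /andP[j1 _].
  by rewrite mulrCA -exprS prednK.
have W'0 : 0 < W'.
  rewrite /W'; case: (alpha n) a0 => // k _; rewrite big_nat_recl//=.
  rewrite mul1r expr0 ltr_pwDl//.
  by apply: sumr_ge0 => j _; rewrite mulr_ge0// exprn_ge0// ltW.
pose F := (fun z : R => n%:R * (geomsum (alpha n) z)^-1).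
have Sgt (z : R) : 0 < z -> geomsum (alpha n) z != 0.
  by move=> z0; rewrite gt_eqF// geomsum_gt0.
have dF : is_derive x 1 F (- n%:R^-1 * W').
  have dS := is_deriveV (Sgt _ x0) (is_derive_geomsum (alpha n) x).
  have -> : - n%:R^-1 * W' = n%:R *: (- geomsum (alpha n) x ^- 2 *: W').
    by rewrite /GRing.scale/= Sx; field; exact: nn.
  exact: is_deriveZ.
have Fx : F x = 1 by rewrite /F Sx divff.
have near0 : \forall z \near x, 0 < z by exact: lt_nbhsr.
have FK : {near x, cancel F (x_sol alpha n)}.
  by apply: filterS near0 => z z0; exact: x_sol_geomsum.
have cF : {near x, continuous F}.
  apply: filterS near0 => z z0; apply: cvgM; first exact: cvg_cst.
  by apply: cvgV; [exact: (Sgt _ z0)|exact: continuous_geomsum].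
have lN : - n%:R^-1 * W' != 0.
  by rewrite mulf_neq0 ?oppr_eq0 ?invr_eq0 ?nn// gt_eqF.
have := is_derive_inverse FK cF dF lN; rewrite Fx derive1E => dg.
rewrite derive_val WE; field.
by rewrite (gt_eqF W'0) (gt_eqF x0) nn.
Qed.

End Saddle.

(** * Summation by parts against inverse rising factorials *)

Section Abel.
Context {R : realType}.
Implicit Types (b c j k n : nat) (x : R).

(** These weights are closed under differences in [j] ([inv_rising_sub]), so that
    summation by parts maps the sum with weight [inv_rising j k] exactly to the
    one with weight [inv_rising j k.+1]; powers of [j^-1] would leave
    correction terms. *)
Definition inv_rising j k : R := \prod_(i < k) ((j + i)%:R)^-1.

Lemma inv_rising_ge0 j k : 0 <= inv_rising j k.
Proof. by apply: prodr_ge0 => i _; rewrite invr_ge0 ler0n. Qed.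

Lemma inv_rising_le j k (C : R) : (0 < j)%N -> j%:R^-1 <= C ->
  inv_rising j k <= C ^+ k.
Proof.
move=> j0 jC; rewrite -[k in leRHS]card_ord -prodr_const.
apply: ler_prod => i _; rewrite invr_ge0 ler0n/=.
by apply: le_trans jC; rewrite lef_pV2 ?posrE ?ltr0n ?addn_gt0 ?j0// ler_nat leq_addr.
Qed.

Lemma inv_rising_sub j k : (0 < j)%N ->
  inv_rising j k - inv_rising j.+1 k = k%:R * inv_rising j k.+1.
Proof.
move=> j0.
have jk0 : (j + k)%:R != 0 :> R by rewrite pnatr_eq0 -lt0n addn_gt0 j0.
have E1 : inv_rising j k = (j + k)%:R * inv_rising j k.+1.
  by rewrite /inv_rising big_ord_recr/= mulrCA divff// mulr1.
have E2 : inv_rising j.+1 k = j%:R * inv_rising j k.+1.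
  rewrite /inv_rising big_ord_recl/= addn0 mulrA divff ?mul1r; last first.
    by rewrite pnatr_eq0 -lt0n.
  by apply: eq_bigr => i _; rewrite /bump/= add1n addSnnS.
by rewrite E1 E2 natrD; ring.
Qed.

(** Telescoping [x ^+ j * inv_rising j k] over [b <= j < c]. *)
Lemma abel_inv_rising x b c k : (0 < b <= c)%N ->
  (x - 1) * (\sum_(b <= j < c) x ^+ j * inv_rising j k) =
  x ^+ c * inv_rising c k - x ^+ b * inv_rising b k
  + k%:R * x * (\sum_(b <= j < c) x ^+ j * inv_rising j k.+1).
Proof.
move=> /andP[b0 bc].
rewrite -(telescope_sumr (fun j => x ^+ j * inv_rising j k) bc).
rewrite !mulr_sumr -big_split/=; apply: eq_big_nat => j /andP[bj _].
have := inv_rising_sub k (leq_trans b0 bj).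
have -> : k%:R * x * (x ^+ j * inv_rising j k.+1) =
  x * x ^+ j * (k%:R * inv_rising j k.+1) by ring.
by move=> <-; rewrite exprS; ring.
Qed.

Lemma harmonic_le_ln b n : (0 < n)%N -> (b <= n)%N ->
  \sum_(1 <= j < b.+1) (j%:R)^-1 <= 1 + ln (n%:R : R).
Proof.
move=> n0 bn.
have lnn : 0 <= ln (n%:R : R) by rewrite ln_ge0// ler1n.
case: b bn => [|b] bn; first by rewrite big_geq// addr_ge0.
apply: (le_trans (y := 1 + ln (b.+1%:R : R))); last first.
  by rewrite lerD2l ler_ln ?posrE ?ltr0n// ler_nat.
elim: b {bn} => [|b IH]; first by rewrite big_nat1 invr1 ln1 addr0.
rewrite big_nat_recr//=; apply: le_trans (lerD IH (lexx _)) _.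
rewrite -addrA lerD2l -lerBrDl.
have b1 : 0 < b.+1%:R :> R by rewrite ltr0n.
have b2 : 0 < b.+2%:R :> R by rewrite ltr0n.
rewrite -lerN2 opprB -ln_div ?posrE//.
have -> : b.+1%:R / b.+2%:R = 1 + - b.+2%:R^-1 :> R.
  by rewrite -(@natr1 R b.+1); field; lra.
by apply: le_ln1Dx; rewrite ltrN2 invf_lt1// ltr1n.
Qed.

End Abel.

(** * Consequences of the growth hypotheses *)

Section Growth.
Context {R : realType}.

Lemma near_lt_limn_esup (f : nat -> \bar R) (l : \bar R) :
  (limn_esup f < l)%E -> \forall n \near \oo, (f n < l)%E.
Proof.
move=> /ereal_inf_lt [_ [V Voo <-]] Vl; apply: filterS Voo => n Vn.
by apply: le_lt_trans Vl; apply: ereal_sup_ubound; exists n.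
Qed.

Lemma negligible_inv_alpha (alpha : nat -> nat) (a0 : R) : 0 < a0 ->
  limn_einf (fun n : nat => (n%:R `^ (- a0) * (alpha n)%:R)%:E) = +oo%E ->
  negligible (fun n => ((alpha n)%:R : R)^-1).
Proof.
move=> a00; rewrite /limn_einf => /eqP; rewrite eqe_oppLR => /eqP /= E.
exists a0 => //.
have /near_lt_limn_esup : (limn_esup (\- (fun n : nat =>
   (n%:R `^ (- a0) * (alpha n)%:R)%:E)) < (- 1)%:E)%E by rewrite E ltNyr.
apply: filterS2 (@near_pos R) => n n0 /=.
rewrite lte_fin ltrN2 powRN => H.
have p0 : 0 < n%:R `^ a0 by exact: powR_gt0.
have H1 : n%:R `^ a0 < (alpha n)%:R by rewrite -[ltLHS]mulr1 -ltr_pdivlMl.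
rewrite ger0_norm ?invr_ge0// lef_pV2 ?posrE//; first exact: ltW.
exact: lt_trans H1.
Qed.

Lemma negligible_inv_ratio (alpha : nat -> nat) (a1 : R) : a1 < 1 ->
  limn_esup (fun n : nat => (n%:R `^ (- a1) * (alpha n)%:R)%:E) = 0%E ->
  negligible (fun n => (n%:R / (alpha n)%:R : R)^-1).
Proof.
move=> a11 E; exists (1 - a1); first by lra.
have /near_lt_limn_esup : (limn_esup (fun n : nat =>
   (n%:R `^ (- a1) * (alpha n)%:R)%:E) < (1 : R)%:E)%E by rewrite E lte_fin.
apply: filterS2 (@near_pos R) => n n0; rewrite lte_fin => H.
rewrite invfM invrK ger0_norm ?mulr_ge0 ?invr_ge0//.
have -> : - (1 - a1) = -1 + a1 by lra.
rewrite powRD; last by apply/implyP => _; rewrite gt_eqF.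
rewrite powR_inv1 ?ler0n// ler_wpM2l ?invr_ge0//.
by apply: ltW; move: H; rewrite powRN ltr_pdivrMl ?powR_gt0// mulr1.
Qed.

End Growth.

(** * The expansions of [m_] and [v_] *)

Section Main.
Context {R : realType} (alpha : nat -> nat).
Context (alpha_pos : forall n : nat, (0 < n)%N -> (0 < alpha n)%N).

Let a n : R := (alpha n)%:R.
Let u n : R := n%:R / a n.
Let X n : R := xi (u n).
Let x n : R := x_sol alpha n 1.
(** The rescaled saddle point: [x n = (1 - s n / a n)^-1]. *)
Let s n : R := a n * (1 - (x n)^-1).

Context (na : negligible (fun n => (a n)^-1)).
Context (nu : negligible (fun n => (u n)^-1)).

Lemma ratio_diverges : diverges u.
Proof.
move=> C; have C0 : 0 < (`|C| + 1)^-1 by rewrite invr_gt0 ltr_wpDl.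
apply: filterS2 (@near_pos R) (negligible_le nu C0) => n n0.
have u0 : 0 < u n by rewrite divr_gt0// ltr0n alpha_pos// -(ltr0n R).
rewrite ger0_norm ?invr_ge0 ?(ltW u0)// lef_pV2 ?posrE ?ltr_wpDl// => H.
by have := ler_norm C; lra.
Qed.

Lemma near_setting : \forall n \near \oo,
  [/\ (0 < n)%N, (0 < alpha n)%N, 1 <= a n, 2 <= u n & u n * a n = n%:R].
Proof.
apply: filterS2 (ratio_diverges 2) (@near_pos R) => n u2; rewrite ltr0n => n0.
have a0 := alpha_pos n0; split=> //; first by rewrite ler1n.
by rewrite /u divfK// pnatr_eq0 -lt0n.
Qed.

Lemma xi_ratio_diverges : diverges X.
Proof.
move=> C; apply: filterS2 (ratio_diverges 2) (ratio_diverges (expR C)) => n u2 uC.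
by rewrite -ler_expR; apply: le_trans uC _; apply: le_expR_xi; lra.
Qed.

Lemma xi_ratio_moderate : moderate X.
Proof.
have m : moderate (fun n => 2 * (ln 2 + ln (n%:R : R))).
  by apply: moderateM (moderate_cst 2) (moderateD (moderate_cst _) moderate_ln).
apply: le_moderate m; apply: filterS near_setting => n [n0 a0 a1 u2 ua].
have u1 : 1 < u n by lra.
have [X0 _] := xiP u1; rewrite ger0_norm ?(ltW X0)//.
apply: le_trans (xi_le_ln u1) _.
have nn : 0 < n%:R :> R by rewrite ltr0n.
rewrite -lnM ?posrE// ler_pM2l// ler_ln ?posrE; nra.
Qed.

Lemma x_sol_power n : (0 < n)%N -> (0 < alpha n)%N ->
  x n ^+ alpha n = 1 + u n * s n.
Proof.
move=> n0 a0; have [x0 Sx] := @x_sol_1P R _ _ a0 n0; rewrite -/(x n) in x0 Sx.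
have := geomsumE (alpha n) (x n); rewrite Sx.
have a0' : a n != 0 by rewrite pnatr_eq0 -lt0n.
rewrite /u /s => H; apply: (mulfI (lt0r_neq0 x0)).
have -> : x n * (1 + n%:R / a n * (a n * (1 - (x n)^-1))) =
  x n + (x n - 1) * n%:R by field; rewrite a0' gt_eqF.
by rewrite H; ring.
Qed.

(** The bound [s <= xi u], with [xi u] negligible against [a], comes first: it
    forces [s / a <= 1 / 2], hence [x <= 2], which the lower bound on [s] and the
    comparison with [xi u] both use. *)
Lemma near_saddle : \forall n \near \oo,
  [/\ 1 < x n, x n <= 2, 2 <= s n, s n <= X n
    & X n - s n <= 4 * s n ^+ 2 / a n].
Proof.
have half : 0 < 2^-1 :> R by rewrite invr_gt0.
have aX := negligible_le (negligibleMr na xi_ratio_moderate) half.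
apply: filterS3 near_setting (ratio_diverges (2 * expR 4)) aX.
move=> n [n0 a0 a1 u2 ua] uE aXn.
have [x0 Sx] := @x_sol_1P R _ _ a0 n0; rewrite -/(x n) in x0 Sx.
have u1 : 1 < u n by lra.
have a0' : 0 < a n by lra.
have x1 : 1 < x n.
  rewrite ltNge; apply/negP => x1.
  have : geomsum (alpha n) (x n) <= a n.
    rewrite /geomsum; apply: (le_trans (y := \sum_(1 <= j < (alpha n).+1) 1)).
      by apply: ler_sum => j _; rewrite exprn_ile1// ltW.
    by rewrite sumr_const_nat subSS subn0.
  by rewrite Sx -ua; nra.
have xV1 : (x n)^-1 < 1 by rewrite invf_lt1.
have s0 : 0 < s n by rewrite mulr_gt0//; lra.
have xP := x_sol_power n0 a0.
have /andP[E1 E2] := exp_sandwich a0 x1 (erefl (s n)).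
rewrite xP in E1 E2.
have sX : s n <= X n by exact: le_xi.
have x2 : x n <= 2.
  rewrite -lef_pV2 ?posrE//.
  have : s n / a n <= 2^-1.
    apply: le_trans aXn; apply: le_trans (ler_norm _).
    by rewrite mulrC ler_wpM2l// invr_ge0 ltW.
  by rewrite /s mulrAC divff ?gt_eqF// mul1r; lra.
have s2 : 2 <= s n.
  have H := saddle_large s0 x2 E2.
  have : expR 4 <= expR (2 * s n) by lra.
  by rewrite ler_expR; lra.
split=> //.
exact: (xi_sub_saddle a0 u1 x1 x2 (erefl (s n)) s2 sX E2).
Qed.

Lemma inv_saddle_eqneg : eqneg (fun n => (s n)^-1) (fun n => (X n)^-1).
Proof.
have ng : negligible (fun n => 4 * X n ^+ 2 * (a n)^-1).
  apply: negligibleMl na; apply: moderateM (moderate_cst 4) _.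
  exact/moderateX/xi_ratio_moderate.
apply: le_negligible ng.
apply: filterS2 near_setting near_saddle.
move=> n [n0 a0 a1 u2 ua] [x1 x2 s2 sX sXa].
have -> : (s n)^-1 - (X n)^-1 = (X n - s n) / (s n * X n).
  by field; rewrite !gt_eqF//; lra.
have XX : 0 <= X n - s n by lra.
have sX1 : 1 <= s n * X n by nra.
rewrite ger0_norm; last by apply: divr_ge0; lra.
rewrite ler_pdivrMr; last by lra.
have h : s n ^+ 2 / a n <= X n ^+ 2 / a n.
  by rewrite ler_pM2r ?invr_gt0 ?lerXn2r ?nnegrE//; lra.
have h0 : 0 <= X n ^+ 2 / a n by apply: divr_ge0; nra.
rewrite -!(mulrA 4) in sXa *.
by move: (s n * X n) (X n ^+ 2 / a n) (s n ^+ 2 / a n) sXa h h0 sX1 => w q h; nra.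
Qed.

(** The sum starts above [alpha n / 2] so that [inv_rising j k] is at most
    [(2 / a n) ^+ k] throughout.  On the full range each summation by parts would
    leave at [j = 1] a boundary term of order [(a n / s n) ^+ k], which may
    exceed [u n] for large [k]. *)
Let P k n : R :=
  \sum_((alpha n)./2.+1 <= j < (alpha n).+1) x n ^+ j * inv_rising j k.

Let p k n : R := a n ^+ k * P k.+1 n / u n.

(** The factors [inv_rising j k.+1 <= (2 / a n) ^+ k.+1] leave a part of the
    geometric sum, whose total is [n = u n * a n]. *)
Lemma half_block_bounded k : bounded_seq (p k).
Proof.
exists (2 ^+ k.+1); apply: filterS2 near_setting near_saddle.
move=> n [n0 a0 a1 u2 ua] [x1 x2 s2 sX sXa].
have [x0 Sx] := @x_sol_1P R _ _ a0 n0; rewrite -/(x n) in x0 Sx.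
have P0 : 0 <= P k.+1 n.
  by apply: sumr_ge0 => j _; rewrite mulr_ge0 ?inv_rising_ge0// exprn_ge0// ltW.
have Pn : P k.+1 n <= n%:R * (2 / a n) ^+ k.+1.
  rewrite -Sx /geomsum (big_cat_nat (n := (alpha n)./2.+1))//=; last first.
    by rewrite ltnS -divn2 leq_div.
  rewrite mulrDl ler_wpDl//.
    apply: mulr_ge0; last by apply/exprn_ge0/divr_ge0; lra.
    by apply: sumr_ge0 => j _; rewrite exprn_ge0// ltW.
  rewrite mulr_suml; apply: ler_sum_nat => j /andP[aj _].
  rewrite ler_wpM2l ?exprn_ge0 ?(ltW x0)//.
  have j0 : (0 < j)%N by exact: leq_trans aj.
  apply: inv_rising_le => //.
  rewrite -[leRHS]invrK lef_pV2 ?posrE ?invr_gt0 ?divr_gt0 ?ltr0n// invf_div.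
  rewrite ler_pdivrMr// -natrM ler_nat muln2.
  by rewrite ltnW// -ltn_half_double.
rewrite ger0_norm; last first.
  apply: divr_ge0; last by lra.
  by apply: mulr_ge0 P0; apply: exprn_ge0; lra.
rewrite ler_pdivrMr; last by lra.
apply: le_trans (ler_wpM2l _ Pn) _; first by rewrite exprn_ge0//; lra.
have -> : a n ^+ k * (n%:R * (2 / a n) ^+ k.+1) = 2 ^+ k.+1 * u n.
  rewrite -ua expr_div_n [a n ^+ k.+1]exprS; field.
  by rewrite expf_neq0 !gt_eqF//; lra.
by [].
Qed.

Lemma inv_rising_corner k :
  eqneg (fun n => a n ^+ k * inv_rising (alpha n).+1 k) (fun=> 1).
Proof.
elim: k => [|k IH].
  by apply: eqneg_near; near=> n; rewrite expr0 /inv_rising big_ord0 mulr1.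
have step : eqneg (fun n => a n / (a n + k.+1%:R)) (fun=> 1).
  have ng := negligibleMl (moderate_cst k.+1%:R) na.
  apply: le_negligible ng; apply: filterS near_setting.
  move=> n [n0 a0 a1 u2 ua].
  have k0 : 0 <= k.+1%:R :> R by [].
  have -> : a n / (a n + k.+1%:R) - 1 = - (k.+1%:R / (a n + k.+1%:R)).
    by field; rewrite gt_eqF//; lra.
  rewrite normrN ger0_norm; last by apply: divr_ge0; lra.
  by rewrite ler_wpM2l// lef_pV2 ?posrE; lra.
have := eqnegM (moderate_cst 1) (moderate_cst 1) IH step.
rewrite mulr1; apply: eqneg_trans; apply: eqneg_near; near=> n.
rewrite /inv_rising big_ord_recr/= exprS addSnnS natrD -/(a n).
by ring.
Unshelve. all: by end_near. Qed.

(** [x ^+ (a / 2)] is at most the square root of [x ^+ a = 1 + u * s]. *)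
Lemma near_half_power : \forall n \near \oo,
  x n ^+ (alpha n)./2 <= s n * u n * Num.sqrt (2 * (u n)^-1).
Proof.
apply: filterS2 near_setting near_saddle.
move=> n [n0 a0 a1 u2 ua] [x1 x2 s2 sX sXa].
have xh0 : 0 <= x n ^+ (alpha n)./2 by apply: exprn_ge0; lra.
rewrite -[leLHS]ger0_norm// -sqrtr_sqr.
have su0 : 0 <= s n * u n by nra.
rewrite -[s n * u n]ger0_norm// -sqrtr_sqr -sqrtrM ?sqr_ge0// ler_wsqrtr//.
rewrite -exprM muln2.
have le_h : x n ^+ (alpha n)./2.*2 <= x n ^+ alpha n.
  apply: ler_weXn2l; first exact: ltW.
  by rewrite -[leqRHS]odd_double_half leq_addl.
apply: le_trans le_h _; rewrite x_sol_power//.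
have -> : (s n * u n) ^+ 2 * (2 / u n) = 2 * s n * (s n * u n).
  by field; rewrite gt_eqF//; lra.
have : 1 <= s n * u n by nra.
by move: su0; rewrite (mulrC (u n)); move: (s n * u n) => w; nra.
Qed.

Lemma inv_ratio_sqrt_negligible : negligible (fun n => Num.sqrt (2 * (u n)^-1)).
Proof. exact/negligible_sqrt/(negligibleMl (moderate_cst 2) nu). Qed.

Lemma half_boundary_negligible k : negligible (fun n =>
  x n ^+ (alpha n)./2 * (a n ^+ k * inv_rising (alpha n)./2.+1 k)
  / (s n * u n)).
Proof.
have ng := negligibleMr inv_ratio_sqrt_negligible (moderate_cst (2 ^+ k)).
apply: le_negligible ng; apply: filterS3 near_setting near_saddle near_half_power.
move=> n [n0 a0 a1 u2 ua] [x1 x2 s2 sX sXa] xh.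
have su0 : 0 < s n * u n by nra.
have xh0 : 0 <= x n ^+ (alpha n)./2 by apply: exprn_ge0; lra.
have r0 : 0 <= a n ^+ k * inv_rising (alpha n)./2.+1 k.
  by rewrite mulr_ge0 ?inv_rising_ge0// exprn_ge0//; lra.
have r2 : a n ^+ k * inv_rising (alpha n)./2.+1 k <= 2 ^+ k.
  have -> : 2 ^+ k = a n ^+ k * (2 / a n) ^+ k.
    by rewrite -exprMn mulrCA divff ?mulr1// gt_eqF//; lra.
  rewrite ler_wpM2l//; first by apply: exprn_ge0; lra.
  apply: inv_rising_le => //.
  rewrite -[leRHS]invrK lef_pV2 ?posrE ?invr_gt0 ?divr_gt0 ?ltr0n// invf_div.
  by rewrite ler_pdivrMr// -natrM ler_nat muln2 ltnW// -ltn_half_double.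
rewrite ger0_norm; last by apply: divr_ge0 (ltW su0); exact: mulr_ge0.
by rewrite ler_pdivrMr// mulrAC (mulrC (Num.sqrt _)); apply: ler_pM.
Qed.

(** One summation by parts: the upper boundary term is
    [(1 + (s * u)^-1) * (a ^+ k.+1 * inv_rising (alpha n).+1 k.+1)], congruent
    to [1], and the lower one, [e], is negligible. *)
Lemma half_block_recursion k :
  eqneg (p k) (fun n => 1 + k.+1%:R * (X n)^-1 * p k.+1 n).
Proof.
have mX := inv_moderate xi_ratio_diverges.
pose e n := x n ^+ (alpha n)./2 *
  (a n ^+ k.+1 * inv_rising (alpha n)./2.+1 k.+1) / (s n * u n).
have main : eqneg (fun n => 1 + (s n * u n)^-1) (fun=> 1).
  apply: le_negligible nu; apply: filterS2 near_setting near_saddle.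
  move=> n [n0 a0 a1 u2 ua] [x1 x2 s2 sX sXa].
  have su0 : 0 < s n * u n by nra.
  rewrite addrAC subrr add0r ger0_norm ?invr_ge0 ?(ltW su0)//.
  by rewrite lef_pV2 ?posrE; nra.
have E1 := eqnegM (moderate_cst 1) (moderate_cst 1) main (inv_rising_corner k.+1).
have E2 : eqneg (fun n => k.+1%:R * (s n)^-1 * p k.+1 n)
                (fun n => k.+1%:R * (X n)^-1 * p k.+1 n).
  apply: eqnegM; last exact: eqneg_refl.
  - exact: moderateM (moderate_cst _) mX.
  - exact/bounded_moderate/half_block_bounded.
  - exact: eqnegM (moderate_cst _) mX (eqneg_refl _) inv_saddle_eqneg.
have ne : eqneg (fun n => - e n) (fun=> 0).
  apply: negligible_near (negligibleN (half_boundary_negligible k.+1)).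
  by near=> n; rewrite subr0.
have := eqnegD (eqnegD E1 ne) E2; rewrite mulr1 addr0.
apply: eqneg_trans; apply: eqneg_near; near=> n.
have [n0 a0 a1 u2 ua] : [/\ (0 < n)%N, (0 < alpha n)%N, 1 <= a n, 2 <= u n
  & u n * a n = n%:R] by near: n; exact: near_setting.
have [x1 x2 s2 sX sXa] : [/\ 1 < x n, x n <= 2, 2 <= s n, s n <= X n
  & X n - s n <= 4 * s n ^+ 2 / a n] by near: n; exact: near_saddle.
have b : (0 < (alpha n)./2.+1 <= (alpha n).+1)%N by rewrite ltn0Sn ltnS -divn2 leq_div.
have := abel_inv_rising (x n) k.+1 b.
have -> : x n - 1 = s n * x n / a n.
  by rewrite /s; field; rewrite !gt_eqF//; lra.
rewrite -/(P k.+1 n) -/(P k.+2 n) !exprS x_sol_power// => H.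
have x0 : x n != 0 by rewrite gt_eqF//; lra.
have an0 : a n != 0 by rewrite gt_eqF//; lra.
have un0 : u n != 0 by rewrite gt_eqF//; lra.
have sn0 : s n != 0 by rewrite gt_eqF//; lra.
have -> : p k n = a n ^+ k.+1 / (s n * u n) / x n * (s n * x n / a n * P k.+1 n).
  by rewrite /p exprS; field; rewrite x0 an0 un0 sn0.
rewrite H /e /p !exprS; field.
by rewrite x0 un0 sn0.
Unshelve. all: by end_near. Qed.

(** The discarded lower half is at most [x ^+ (a / 2)] times a harmonic sum. *)
Lemma m_eqneg_half_block : eqneg (fun n => m_ alpha n / u n) (p 0).
Proof.
have ng := negligibleMr inv_ratio_sqrt_negligible
  (moderateM xi_ratio_moderate (moderateD (moderate_cst 1) moderate_ln)).
apply: le_negligible ng.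
apply: filterS3 near_setting near_saddle near_half_power.
move=> n [n0 a0 a1 u2 ua] [x1 x2 s2 sX sXa] xh.
pose low : R := \sum_(1 <= j < (alpha n)./2.+1) x n ^+ j / j%:R.
have mE : m_ alpha n = low + P 1 n.
  rewrite /m_ (big_cat_nat (n := (alpha n)./2.+1))//=; last first.
    by rewrite ltnS -divn2 leq_div.
  rewrite /P; congr (_ + _); apply: eq_bigr => j _.
  by rewrite /inv_rising big_ord1 addn0.
have -> : m_ alpha n / u n - p 0 n = low / u n.
  by rewrite /p mE expr0; field; rewrite gt_eqF//; lra.
have lnn : 0 <= ln (n%:R : R) by rewrite ln_ge0// ler1n.
have low0 : 0 <= low.
  by apply: sumr_ge0 => j _; rewrite divr_ge0// exprn_ge0//; lra.
have xh0 : 0 <= x n ^+ (alpha n)./2 by apply: exprn_ge0; lra.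
have alpha_n : ((alpha n)./2 <= n)%N.
  rewrite -divn2; apply: leq_trans (leq_div _ 2) _.
  rewrite -(ler_nat R) -ua -/(a n).
  by rewrite ler_peMl//; lra.
have lowle : low <= x n ^+ (alpha n)./2 * (1 + ln (n%:R)).
  apply: le_trans (ler_wpM2l xh0 (harmonic_le_ln n0 alpha_n)).
  rewrite /low mulr_sumr; apply: ler_sum_nat => j /andP[_ jh].
  by rewrite ler_wpM2r ?invr_ge0// ler_weXn2l// ltW.
rewrite ger0_norm; last by apply: divr_ge0; lra.
rewrite ler_pdivrMr; last by lra.
apply: le_trans lowle _.
have -> : Num.sqrt (2 / u n) * (X n * (1 + ln n%:R)) * u n =
  X n * u n * Num.sqrt (2 / u n) * (1 + ln n%:R) by ring.
rewrite ler_wpM2r ?addr_ge0//; apply: le_trans xh _.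
by rewrite ler_wpM2r ?sqrtr_ge0// ler_wpM2r//; lra.
Qed.

Lemma scale_norm k : \forall n \near \oo, `|@scale R alpha k n| = u n * X n ^- k.
Proof.
apply: filterS2 near_setting near_saddle.
move=> n [n0 a0 a1 u2 ua] [x1 x2 s2 sX sXa].
rewrite ger0_norm// /scale -/(u n) -/(X n) mulr_ge0 ?invr_ge0 ?exprn_ge0//; lra.
Qed.

Lemma scaled_expansion (f : nat -> R) (c : nat -> R) N C :
  (\forall n \near \oo,
    `|f n / u n - \sum_(k < N.+1) c k * X n ^- k| <= C * X n ^- N.+1) ->
  \forall n \near \oo,
    `|f n - \sum_(0 <= k < N.+1) c k * scale alpha k n|
      <= C * `|scale alpha N.+1 n|.
Proof.
move=> H; apply: filterS3 near_setting (scale_norm N.+1) H.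
move=> n [n0 a0 a1 u2 ua] -> H.
have -> : f n - \sum_(0 <= k < N.+1) c k * scale alpha k n =
  u n * (f n / u n - \sum_(k < N.+1) c k * X n ^- k).
  rewrite mulrBr big_mkord mulr_sumr; congr (_ - _).
    by rewrite mulrC divfK// gt_eqF//; lra.
  by apply: eq_bigr => k _; rewrite /scale -/(u n) -/(X n); ring.
rewrite normrM ger0_norm; last by lra.
by rewrite mulrCA ler_wpM2l//; lra.
Qed.

Lemma m_dominated N : exists C, \forall n \near \oo,
  `|m_ alpha n - \sum_(0 <= k < N.+1) k`!%:R * @scale R alpha k n|
    <= C * `|@scale R alpha N.+1 n|.
Proof.
(* The recursion starts from [m_ / u] itself, which is congruent to [p 0]. *)
pose q k n := if k is 0 then m_ alpha n / u n else p k n.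
have q0 : eqneg (q 0) (p 0) by exact: m_eqneg_half_block.
have bq k : bounded_seq (q k).
  case: k => [|k]; last exact: half_block_bounded.
  have [B HB] := half_block_bounded 0; exists (1 + B).
  apply: filterS2 HB (negligible_le q0 ltr01) => n pn qn.
  rewrite -[q 0%N n](subrK (p 0 n)).
  exact: le_trans (ler_normD _ _) (lerD qn pn).
have rec k : eqneg (q k) (fun n => 1 + k.+1%:R * (X n)^-1 * q k.+1 n).
  case: k => [|k]; last exact: half_block_recursion.
  by apply: eqneg_trans q0 _; exact: half_block_recursion.
have [C HC] := recursion_expansion (c := fun k => k.+1%:R)
  xi_ratio_diverges xi_ratio_moderate bq rec N.
exists C; apply: (scaled_expansion (c := fun k => k`!%:R)).
apply: filterS HC => n; congr (`|_ - _| <= _).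
by apply: eq_bigr => k _; rewrite fact_prod big_add1 big_mkord natr_prod.
Qed.

(** The exact correction for which [n * x' / x = - u / (1 - z)]; its first
    term [1 / s] is the leading one. *)
Let z n := (s n)^-1 - (u n * s n)^-1 - (a n)^-1.

Lemma v_gap : \forall n \near \oo, v_ alpha n = m_ alpha n - u n / (1 - z n).
Proof.
apply: filterS2 near_setting near_saddle.
move=> n [n0 a0 a1 u2 ua] [x1 x2 s2 sX sXa].
have [x0 Sx] := @x_sol_1P R _ _ a0 n0; rewrite -/(x n) in x0 Sx.
rewrite /v_ dlog_x_sol// -/(x n) mulrN; congr (_ - _).
have := geomsum_weighted (alpha n) (x n); rewrite Sx.
set W := \sum_(1 <= j < _) _.
rewrite exprS x_sol_power// -/(a n) -ua.
have x0' : x n != 0 by rewrite gt_eqF//; lra.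
have an0 : a n != 0 by rewrite gt_eqF//; lra.
have un0 : u n != 0 by rewrite gt_eqF//; lra.
have sn0 : s n != 0 by rewrite gt_eqF//; lra.
have xE : x n - 1 = s n * x n / a n by rewrite /s; field; rewrite an0.
have xE1 : u n = u n * x n * (1 - s n / a n).
  by rewrite /s; field; rewrite an0 x0'.
rewrite xE.
have z1 : 0 < 1 - z n.
  have : (s n)^-1 <= 2^-1 by rewrite lef_pV2 ?posrE//; lra.
  have : 0 < (u n * s n)^-1 by rewrite invr_gt0; nra.
  have : 0 < (a n)^-1 by rewrite invr_gt0; lra.
  by rewrite /z; lra.
move=> WE.
(* The weighted sum is [n ^+ 2 * (1 - z) / u], so that [n * (n / W)] is
   [u / (1 - z)]. *)
have {}WE : W = u n * a n * a n * (1 - z n).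
  have -> : W = s n * x n / a n * W * (a n / (s n * x n)).
    by field; rewrite an0 sn0 x0'.
  rewrite WE {2}xE1 /z; field.
  by rewrite an0 sn0 x0' un0.
rewrite WE; field.
by rewrite an0 un0 gt_eqF.
Qed.

Lemma v_dominated N : (2 <= N)%N -> exists C, \forall n \near \oo,
  `|v_ alpha n - \sum_(2 <= k < N.+1) (k`!%:R - 1) * @scale R alpha k n|
    <= C * `|@scale R alpha N.+1 n|.
Proof.
move=> N2; pose t n := (1 - z n)^-1.
have near_z : \forall n \near \oo, 2^-1 <= 1 - z n.
  apply: filterS2 near_setting near_saddle.
  move=> n [n0 a0 a1 u2 ua] [x1 x2 s2 sX sXa].
  have : (s n)^-1 <= 2^-1 by rewrite lef_pV2 ?posrE//; lra.
  have : 0 < (u n * s n)^-1 by rewrite invr_gt0; nra.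
  have : 0 < (a n)^-1 by rewrite invr_gt0; lra.
  by rewrite /z; lra.
have bt : bounded_seq t.
  exists 2; apply: filterS near_z => n zn.
  have z0 : 0 < 1 - z n by lra.
  by rewrite ger0_norm ?invr_ge0 ?(ltW z0)// -[leRHS]invrK lef_pV2 ?posrE ?invr_gt0.
have mX := inv_moderate xi_ratio_diverges.
have zX : eqneg z (fun n => (X n)^-1).
  have nq : negligible (fun n => (u n * s n)^-1).
    apply: le_negligible nu; apply: filterS2 near_setting near_saddle.
    move=> n [n0 a0 a1 u2 ua] [x1 x2 s2 sX sXa].
    have us0 : 0 < u n * s n by nra.
    by rewrite ger0_norm ?invr_ge0 ?(ltW us0)// lef_pV2 ?posrE; nra.
  apply: negligible_near (negligibleB (negligibleB inv_saddle_eqneg nq) na).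
  by near=> n; rewrite /z; ring.
have rec (k : nat) : eqneg t (fun n => 1 + 1 * (X n)^-1 * t n).
  have zt := eqnegM mX (bounded_moderate bt) zX (eqneg_refl t).
  have := eqnegD (eqneg_refl (fun=> 1)) zt.
  rewrite (_ : (fun n => 1 + (X n)^-1 * t n) = (fun n => 1 + 1 * (X n)^-1 * t n)).
    apply: eqneg_trans; apply: eqneg_near; apply: filterS near_z => n zn.
    by rewrite /t; field; rewrite gt_eqF//; lra.
  by apply/funext => n; rewrite mul1r.
have [C HC] := recursion_expansion (c := fun=> 1) (q := fun=> t)
  xi_ratio_diverges xi_ratio_moderate (fun=> bt) rec N.
have tE : \forall n \near \oo,
    `|(u n * t n) / u n - \sum_(k < N.+1) 1 * X n ^- k| <= C * X n ^- N.+1.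
  apply: filterS2 near_setting HC => n [n0 a0 a1 u2 ua].
  have -> : u n * t n / u n = t n.
    by rewrite mulrAC divff ?mul1r// gt_eqF//; lra.
  congr (`|_ - _| <= _).
  by apply: eq_bigr => k _; rewrite big1.
have [D HD] := m_dominated N.
have {}tE := scaled_expansion (f := fun n => u n * t n) (c := fun=> 1) tE.
exists (D + C); apply: filterS3 HD tE v_gap => n mn tn ->.
have -> : \sum_(2 <= k < N.+1) (k`!%:R - 1) * @scale R alpha k n =
    \sum_(0 <= k < N.+1) k`!%:R * @scale R alpha k n
    - \sum_(0 <= k < N.+1) 1 * @scale R alpha k n.
  (* The terms [k = 0] and [k = 1] cancel because [0! = 1! = 1]. *)
  rewrite -sumrB [RHS](big_cat_nat (n := 2))//=; last exact: leqW.
  rewrite [X in _ = X + _]big1_seq ?add0r.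
    by apply: eq_bigr => k _; rewrite mulrBl.
  by move=> [|[|k]]; rewrite mem_index_iota// => _; rewrite subrr.
move: mn tn; set M := \sum_(0 <= k < _) _; set T := \sum_(0 <= k < _) _ => mn tn.
have -> : m_ alpha n - u n / (1 - z n) - (M - T) =
  (m_ alpha n - M) - (u n * t n - T) by rewrite /t; ring.
rewrite mulrDl; exact: le_trans (ler_normB _ _) (lerD mn tn).
Unshelve. all: by end_near. Qed.

End Main.

Theorem theorem2 (R : realType) (alpha : nat -> nat)
    (alpha_pos : forall n : nat, (0 < n)%N -> (0 < alpha n)%N)
    (growth : exists a0 a1 : R,
      [/\ 0 < a0 < 1, 0 < a1 < 1,
          limn_einf (fun n : nat =>
            (n%:R `^ (- a0) * (alpha n)%:R)%:E) = +oo%E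
        & limn_esup (fun n : nat =>
            (n%:R `^ (- a1) * (alpha n)%:R)%:E) = 0%E]) :
  @asymptotic_expansion R (m_ alpha) 0 (fun k => (k`!)%:R) (scale alpha) /\
  @asymptotic_expansion R (v_ alpha) 2 (fun k => (k`!)%:R - 1) (scale alpha).
Proof.
have [a0 [a1 [/andP[a00 _] /andP[_ a11] linf lsup]]] := growth.
have na := negligible_inv_alpha a00 linf.
have nu := negligible_inv_ratio a11 lsup.
have dX := xi_ratio_diverges alpha_pos nu.
split; apply: expansion_of_dominated dX _ => N kN.
  exact: m_dominated.
exact: v_dominated.
Qed.
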